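(* For $x>0$, $n\in\{0,1,2,\ldots\}$ and $\kappa\in\mathbb{R}$ with $2\kappa\notin\{0,-1,-2,\ldots\}$, $$\mathrm{mi}_{\kappa+n,\,\kappa-1/2}(x)=2^{\kappa}\sum_{m=0}^{n}\binom{n}{m}\frac{(-2)^m}{(2\kappa)_m}\,\Gamma\left(\kappa+m,\,x/2\right).$$
   Context: The Whittaker function is $\mathrm{M}_{\kappa,\mu}(x)=x^{\mu+1/2}e^{-x/2}\,{}_1F_1\!\left(\tfrac12+\mu-\kappa;\,1+2\mu;\,x\right)$, $2\mu\neq-1,-2,\ldots$, and the integral Whittaker function is $\mathrm{mi}_{\kappa,\mu}(x)=\int_x^\infty\frac{\mathrm{M}_{\kappa,\mu}(t)}{t}dt$. $\Gamma(\nu,z)=\int_z^\infty t^{\nu-1}e^{-t}dt$ is the upper incomplete gamma function and $(a)_m=a(a+1)\cdots(a+m-1)$ the Pochhammer symbol. *)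

(* Defs.v *)
From Stdlib Require Import Reals Factorial.
From Coquelicot Require Import Coquelicot.
Open Scope R_scope.

Fixpoint pochhammer (a : R) (m : nat) : R :=
  match m with
  | O => 1
  | S k => pochhammer a k * (a + INR k)
  end.

(* Kummer's series has infinite radius of convergence, so [PSeries] is its
   sum for every [x]; meaningful only when [b] is not 0, -1, -2, ... *)
Definition hyp1F1 (a b x : R) : R :=
  PSeries (fun k => pochhammer a k / (pochhammer b k * INR (fact k))) x.

(* [Rpower] is the real power for a positive base, so this is for [0 < x]. *)
Definition whittakerM (kappa mu x : R) : R :=
  Rpower x (mu + 1 / 2) * exp (- x / 2)
  * hyp1F1 (1 / 2 + mu - kappa) (1 + 2 * mu) x.

Definition whittaker_mi_integrand (kappa mu t : R) : R :=
  whittakerM kappa mu t / t.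

(* [RInt_gen] is the value of the improper Riemann integral only when that
   integral converges. *)
Definition whittaker_mi (kappa mu x : R) : R :=
  RInt_gen (whittaker_mi_integrand kappa mu)
    (at_point x) (Rbar_locally p_infty).

(* For [0 < z] the integral converges for every real [nu]. *)
Definition upper_gamma (nu z : R) : R :=
  RInt_gen (fun t => Rpower t (nu - 1) * exp (- t))
    (at_point z) (Rbar_locally p_infty).

(* Main.v *)
(* At [mu = kappa - 1/2] the first Kummer parameter is [-n], so [1F1] is a
   polynomial and the integrand is a finite combination of the functions
   [t^(kappa+m-1) e^(-t/2)]; the substitution [t = 2 s] turns the integral of
   each of them over [x, oo) into [2^(kappa+m) Gamma(kappa+m, x/2)]. *)

Require Import Defs.
From Stdlib Require Import Reals Factorial Lra Lia.
From Coquelicot Require Import Coquelicot.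
Open Scope R_scope.

(** * Terminating Kummer series *)

Lemma pochhammer_neg (n k : nat) : (k <= n)%nat ->
  pochhammer (- INR n) k = (-1) ^ k * (INR (fact n) / INR (fact (n - k))).
Proof.
induction k as [|k IH]; intros Hk; simpl pochhammer.
- rewrite Nat.sub_0_r. simpl pow. field. apply INR_fact_neq_0.
- rewrite IH by lia.
  replace (n - k)%nat with (S (n - S k)) by lia.
  rewrite fact_simpl, mult_INR, S_INR, minus_INR, S_INR by lia. simpl pow.
  assert (INR k + 1 <= INR n) by (rewrite <- S_INR; apply le_INR; lia).
  field. split; [apply INR_fact_neq_0 | lra].
Qed.

Lemma pochhammer_neg_eq0 (n k : nat) : (n < k)%nat ->
  pochhammer (- INR n) k = 0.
Proof.
intros Hk. induction Hk as [|k Hk IH]; simpl.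
- ring.
- rewrite IH. ring.
Qed.

Lemma pochhammer_neq0 (a : R) (k : nat) :
  (forall j : nat, a <> - INR j) -> pochhammer a k <> 0.
Proof.
intros Ha. induction k as [|k IH]; simpl.
- lra.
- apply Rmult_integral_contrapositive_currified; [exact IH|].
  specialize (Ha k). lra.
Qed.

Lemma PSeries_finite_support (a : nat -> R) (n : nat) (x : R) :
  (forall k : nat, (n < k)%nat -> a k = 0) ->
  PSeries a x = sum_f_R0 (fun k => a k * x ^ k) n.
Proof.
intros Ha. apply is_series_unique.
apply (is_lim_seq_ext_loc
  (fun _ => sum_f_R0 (fun k => a k * x ^ k) n) _ (Finite _));
  [|apply is_lim_seq_const].
exists n. intros N HN. rewrite sum_n_Reals.
induction HN as [|N HN IH]; [reflexivity|].
simpl. rewrite <- IH, Ha by lia. ring.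
Qed.

(** Since [(-n)_m = (-1)^m n! / (n-m)!] for [m <= n], dividing by [m!] leaves [(-1)^m] times a
    binomial coefficient; for [m > n] the product [(-n)_m] contains the factor [-n + n = 0]. *)
Lemma hyp1F1_neg (n : nat) (b x : R) : (forall j : nat, b <> - INR j) ->
  hyp1F1 (- INR n) b x =
  sum_f_R0 (fun m => Binomial.C n m * ((-1) ^ m / pochhammer b m) * x ^ m) n.
Proof.
intros Hb. unfold hyp1F1. rewrite (PSeries_finite_support _ n).
- apply sum_eq. intros m Hm. rewrite pochhammer_neg by exact Hm.
  unfold Binomial.C. field.
  repeat split; try apply INR_fact_neq_0. now apply pochhammer_neq0.
- intros k Hk. rewrite pochhammer_neg_eq0 by exact Hk. unfold Rdiv. ring.
Qed.

(** * Convergence and linearity of improper integrals *)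

(** For a nonnegative integrand the partial integrals increase with the upper endpoint, so being
    bounded they converge to their supremum [l]. *)
Lemma ex_RInt_gen_nonneg_bounded (f : R -> R) (a M : R) :
  (forall b, a <= b -> ex_RInt f a b) ->
  (forall t, a <= t -> 0 <= f t) ->
  (forall b, a <= b -> RInt f a b <= M) ->
  ex_RInt_gen f (at_point a) (Rbar_locally p_infty).
Proof.
intros Hex Hpos HM.
destruct (completeness (fun y => exists b, a <= b /\ y = RInt f a b))
  as [l [Hub Hlub]].
- exists M. intros y [b [Hb ->]]. now apply HM.
- exists (RInt f a a), a. split; [lra | reflexivity].
- assert (Hmono : forall b c, a <= b -> b <= c -> RInt f a b <= RInt f a c).
  { intros b c Hb Hc.
    assert (Hbc : ex_RInt f b c).
    { apply (ex_RInt_Chasles_2 f a b c); [lra | apply Hex; lra]. }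
    rewrite <- (RInt_Chasles f a b c) by (try exact Hbc; apply Hex; lra).
    assert (0 <= RInt f b c).
    { apply RInt_ge_0; [lra | exact Hbc | intros; apply Hpos; lra]. }
    unfold plus; simpl. lra. }
  exists l. intros P [eps HP].
  (* Otherwise [l - eps] would be an upper bound smaller than the least one. By monotonicity every
     [b > b0] then has its integral within [eps] of [l]. *)
  assert (Hb0 : exists b0, a <= b0 /\ l - eps < RInt f a b0).
  { destruct (Classical_Prop.classic
      (exists b0, a <= b0 /\ l - eps < RInt f a b0)) as [|Hno]; [assumption|].
    exfalso. assert (l <= l - eps); [|destruct eps; simpl in *; lra].
    apply Hlub. intros y [b [Hb ->]]. apply Rnot_lt_le. intros Hlt.
    apply Hno. now exists b. }
  destruct Hb0 as [b0 [Hab0 Hb0]].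
  apply (Filter_prod _ _ _ (fun u => u = a) (fun b => b0 < b)).
  + reflexivity.
  + now exists b0.
  + intros u b -> Hb. exists (RInt f a b). simpl. split.
    * apply (RInt_correct f), Hex. lra.
    * apply HP.
      assert (RInt f a b <= l) by (apply Hub; exists b; split; [lra | easy]).
      assert (RInt f a b0 <= RInt f a b) by (apply Hmono; lra).
      apply Rabs_def1; unfold minus, plus, opp; simpl;
        destruct eps; simpl in *; lra.
Qed.

Lemma is_RInt_gen_sum_f_R0 (f : nat -> R -> R) (l : nat -> R) (n : nat)
  (Fa Fb : (R -> Prop) -> Prop) {FFa : Filter Fa} {FFb : Filter Fb} :
  (forall m, is_RInt_gen (f m) Fa Fb (l m)) ->
  is_RInt_gen (fun t => sum_f_R0 (fun m => f m t) n) Fa Fb (sum_f_R0 l n).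
Proof.
intros H. induction n as [|n IH]; simpl; [apply H|].
apply (is_RInt_gen_plus _ (f (S n)) _ _ IH (H (S n))).
Qed.

(** * The upper incomplete gamma integral and its rescaling *)

Lemma is_RInt_exp_half (a b : R) :
  is_RInt (fun t => exp (- t / 2)) a b (2 * exp (- a / 2) - 2 * exp (- b / 2)).
Proof.
replace (2 * exp (- a / 2) - 2 * exp (- b / 2))
  with (minus (- 2 * exp (- b / 2)) (- 2 * exp (- a / 2)))
  by (unfold minus, plus, opp; simpl; ring).
apply (is_RInt_derive (fun t => - 2 * exp (- t / 2))); intros t _.
- auto_derive; [easy|]. unfold Rdiv. field.
- apply (ex_derive_continuous (V := R_NormedModule)). now auto_derive.
Qed.

(** An integrable majorant on [[z, oo)], valid for either sign of [p]: the choice of [q] ensures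
    both [q > 0] and [q >= p], and the scale [2 * q] makes the linear bound on [q ln t] grow like
    [t / 2], which uses up exactly half of the exponential decay. *)
Lemma upper_gamma_integrand_le (z p t : R) : 0 < z -> z <= t ->
  let q := Rabs p + 1 in
  Rpower t p * exp (- t)
  <= exp (q * ln (2 * q) - q + (p - q) * ln z) * exp (- t / 2).
Proof.
intros Hz Ht q. unfold Rpower. rewrite <- !exp_plus.
assert (Hq : 0 < q) by (unfold q; pose proof (Rabs_pos p); lra).
assert (Hpq : p - q <= 0) by (unfold q; pose proof (Rle_abs p); lra).
(* [p ln t = q ln t + (p - q) ln t]: the first term is bounded by
   [ln s <= s - 1] at [s = t / (2 q)], the second by [ln z <= ln t]. *)
assert (H1 : ln t <= t / (2 * q) - 1 + ln (2 * q)).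
{ replace (ln t) with (ln (t / (2 * q)) + ln (2 * q)).
  - pose proof (exp_ineq1_le (ln (t / (2 * q)))) as H.
    rewrite exp_ln in H by (apply Rdiv_lt_0_compat; lra). lra.
  - rewrite <- ln_mult by (try apply Rdiv_lt_0_compat; lra).
    f_equal. field. lra. }
assert (H2 : ln z <= ln t) by (apply ln_le; lra).
assert (H3 : q * ln t <= t / 2 - q + q * ln (2 * q)).
{ replace (t / 2 - q + q * ln (2 * q))
    with (q * (t / (2 * q) - 1 + ln (2 * q))) by (field; lra).
  apply Rmult_le_compat_l; lra. }
assert (H4 : (p - q) * ln t <= (p - q) * ln z)
  by (apply Rmult_le_compat_neg_l; lra).
assert (H : p * ln t + - t
  <= q * ln (2 * q) - q + (p - q) * ln z + - t / 2) by lra.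
destruct H as [H | H]; [left; now apply exp_increasing | rewrite H; lra].
Qed.

(** [upper_gamma] is a bare [RInt_gen], so convergence must be established before its value can be
    used; it follows by comparison with [K * exp (- t / 2)]. *)
Lemma is_RInt_gen_upper_gamma (nu z : R) : 0 < z ->
  is_RInt_gen (fun t => Rpower t (nu - 1) * exp (- t))
    (at_point z) (Rbar_locally p_infty) (upper_gamma nu z).
Proof.
intros Hz. apply (RInt_gen_correct (V := R_CompleteNormedModule)).
assert (Hex : forall b, z <= b ->
  ex_RInt (fun t => Rpower t (nu - 1) * exp (- t)) z b).
{ intros b Hb. apply (ex_RInt_continuous (V := R_CompleteNormedModule)).
  intros t Ht. rewrite Rmin_left in Ht by exact Hb.
  apply (ex_derive_continuous (V := R_NormedModule)).
  unfold Rpower. auto_derive. lra. }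
set (q := Rabs (nu - 1) + 1).
set (K := exp (q * ln (2 * q) - q + (nu - 1 - q) * ln z)).
(* The bound is the integral of the majorant over all of [[z, oo)]. *)
apply (ex_RInt_gen_nonneg_bounded _ z (K * (2 * exp (- z / 2)))).
- exact Hex.
- intros t _. apply Rmult_le_pos; left; apply exp_pos.
- intros b Hb.
  assert (HK : is_RInt (fun t => K * exp (- t / 2)) z b
    (K * (2 * exp (- z / 2) - 2 * exp (- b / 2)))).
  { apply (is_RInt_scal (fun t => exp (- t / 2))). apply is_RInt_exp_half. }
  apply Rle_trans with (RInt (fun t => K * exp (- t / 2)) z b).
  + apply RInt_le; [exact Hb | now apply Hex | eexists; exact HK |].
    intros t Ht. apply upper_gamma_integrand_le; lra.
  + rewrite (is_RInt_unique _ _ _ _ HK).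
    apply Rmult_le_compat_l; [left; apply exp_pos|].
    pose proof (exp_pos (- b / 2)). lra.
Qed.

(** Linear substitution on each finite interval; the endpoint [c * b] passes a threshold [M] as soon
    as [b > M / c], so the limit at infinity is preserved. *)
Lemma is_RInt_gen_scale (f : R -> R) (c a l : R) : 0 < c ->
  is_RInt_gen f (at_point (c * a)) (Rbar_locally p_infty) l ->
  is_RInt_gen (fun t => c * f (c * t)) (at_point a) (Rbar_locally p_infty) l.
Proof.
intros Hc Hf P HP. destruct (Hf P HP) as [Q S HQ [M HM] HQS].
apply (Filter_prod _ _ _ (fun u => u = a) (fun b => M / c < b)).
- reflexivity.
- now exists (M / c).
- intros u b -> Hb.
  destruct (HQS (c * a) (c * b)) as [y [Hy HPy]].
  + exact HQ.
  + apply HM. apply Rmult_lt_compat_l with (r := c) in Hb; [|exact Hc].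
    replace (c * (M / c)) with M in Hb by (field; lra). exact Hb.
  + exists y. split; [|exact HPy]. simpl in *.
    apply (is_RInt_ext (fun t => scal c (f (c * t + 0)))).
    * intros t _. now rewrite Rplus_0_r.
    * apply (is_RInt_comp_lin f c 0 a b). now rewrite !Rplus_0_r.
Qed.

Lemma is_RInt_gen_Rpower_exp_half (nu x : R) : 0 < x ->
  is_RInt_gen (fun t => Rpower t (nu - 1) * exp (- t / 2))
    (at_point x) (Rbar_locally p_infty)
    (Rpower 2 nu * upper_gamma nu (x / 2)).
Proof.
intros Hx.
assert (H : is_RInt_gen (fun t => Rpower t (nu - 1) * exp (- t))
  (at_point (/ 2 * x)) (Rbar_locally p_infty) (upper_gamma nu (x / 2))).
{ replace (x / 2) with (/ 2 * x) by field.
  apply is_RInt_gen_upper_gamma. lra. }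
apply is_RInt_gen_scale in H; [|lra].
apply (is_RInt_gen_scal _ (Rpower 2 nu)) in H.
revert H. apply is_RInt_gen_ext.
(* The integrands need to agree only between the endpoints; taking [b > x] keeps [t] positive there,
   as the power laws require. *)
apply (Filter_prod _ _ _ (fun u => u = x) (fun b => x < b)).
- reflexivity.
- now exists x.
- intros u b -> Hb t. simpl. rewrite Rmin_left by lra. intros Ht.
  unfold scal; simpl; unfold mult; simpl.
  replace (Rpower t (nu - 1)) with (Rpower (2 * (/ 2 * t)) (nu - 1))
    by (f_equal; field).
  rewrite <- (Rpower_mult_distr 2) by lra.
  (* The factor [2] cancels the Jacobian [/ 2], and [2^(nu-1)] turns [(t/2)^(nu-1)] into
     [t^(nu-1)]. *)
  replace (Rpower 2 nu) with (Rpower 2 (nu - 1) * 2).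
  + replace (- (/ 2 * t)) with (- t / 2) by field. field.
  + rewrite <- (Rpower_1 2) at 2 by lra. rewrite <- Rpower_plus.
    f_equal. ring.
Qed.

(** * Termwise integration of the Whittaker function *)

Lemma whittaker_mi_integrand_polynomial (kappa t : R) (n : nat) :
  0 < t -> (forall k : nat, 2 * kappa <> - INR k) ->
  whittaker_mi_integrand (kappa + INR n) (kappa - 1 / 2) t =
  sum_f_R0 (fun m => Binomial.C n m * ((-1) ^ m / pochhammer (2 * kappa) m)
    * (Rpower t (kappa + INR m - 1) * exp (- t / 2))) n.
Proof.
intros Ht Hk. unfold whittaker_mi_integrand, whittakerM.
replace (1 / 2 + (kappa - 1 / 2) - (kappa + INR n)) with (- INR n) by field.
replace (1 + 2 * (kappa - 1 / 2)) with (2 * kappa) by field.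
replace (kappa - 1 / 2 + 1 / 2) with kappa by ring.
rewrite hyp1F1_neg by exact Hk.
unfold Rdiv at 1. rewrite Rmult_comm, <- Rmult_assoc, scal_sum.
apply sum_eq. intros m _.
(* The exponent is written as a sum so that the power splits into [t^kappa], [t^m] and [/ t]. *)
replace (kappa + INR m - 1) with (kappa + INR m + - (1)) by ring.
rewrite !Rpower_plus, Rpower_Ropp, Rpower_1, Rpower_pow by exact Ht.
ring.
Qed.

Theorem theorem37 (x kappa : R) (n : nat)
  (hx : 0 < x)
  (hkappa : forall k : nat, 2 * kappa <> - INR k) :
  ex_RInt_gen (whittaker_mi_integrand (kappa + INR n) (kappa - 1 / 2))
    (at_point x) (Rbar_locally p_infty)
  /\ whittaker_mi (kappa + INR n) (kappa - 1 / 2) x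
     = Rpower 2 kappa
       * sum_f_R0
           (fun m => Binomial.C n m * ((-2) ^ m / pochhammer (2 * kappa) m)
                     * upper_gamma (kappa + INR m) (x / 2)) n.
Proof.
match goal with |- _ /\ _ = ?r => set (rhs := r) end.
(* This one statement yields both the convergence and the value. *)
assert (H : is_RInt_gen
  (whittaker_mi_integrand (kappa + INR n) (kappa - 1 / 2))
  (at_point x) (Rbar_locally p_infty) rhs).
{ unfold rhs. rewrite scal_sum.
  apply (is_RInt_gen_ext (fun t => sum_f_R0 (fun m =>
    Binomial.C n m * ((-1) ^ m / pochhammer (2 * kappa) m)
    * (Rpower t (kappa + INR m - 1) * exp (- t / 2))) n)).
  - apply (Filter_prod _ _ _ (fun u => u = x) (fun b => x < b)).
    + reflexivity.
    + now exists x.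
    + intros u b -> Hb t. simpl. rewrite Rmin_left by lra. intros Ht.
      symmetry. apply whittaker_mi_integrand_polynomial; [lra | exact hkappa].
  - apply is_RInt_gen_sum_f_R0 with (f := fun m t =>
      Binomial.C n m * ((-1) ^ m / pochhammer (2 * kappa) m)
      * (Rpower t (kappa + INR m - 1) * exp (- t / 2)));
      try typeclasses eauto.
    intros m.
    (* The [m]-th integral contributes [2^(kappa+m)]; its part [2^m] merges with [(-1)^m] into
       [(-2)^m], and [2^kappa] is common to all terms. *)
    replace (Binomial.C n m * ((-2) ^ m / pochhammer (2 * kappa) m)
        * upper_gamma (kappa + INR m) (x / 2) * Rpower 2 kappa)
      with (Binomial.C n m * ((-1) ^ m / pochhammer (2 * kappa) m)
        * (Rpower 2 (kappa + INR m) * upper_gamma (kappa + INR m) (x / 2))).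
    + apply (is_RInt_gen_scal (fun t =>
        Rpower t (kappa + INR m - 1) * exp (- t / 2))).
      now apply is_RInt_gen_Rpower_exp_half.
    + rewrite Rpower_plus, Rpower_pow by lra.
      replace (-2) with (-1 * 2) by ring. rewrite Rpow_mult_distr.
      unfold Rdiv. ring. }
split; [now exists rhs | now apply is_RInt_gen_unique].
Qed.
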